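(* Let $M=(V,\beta)$ be a binary matroid, described by its set of bases $\beta$ and viewed as the set system $(V,\beta)$. Then $d_{M\,\bar{*}\,V}=\dim(C\cap C^{\perp})$, where $C$ is the cycle space of $M$ and $C^\perp$ its orthogonal complement (the cocycle space); i.e., $d_{M\,\bar{*}\,V}$ equals the dimension of the bicycle space of $M$.
   Context: For a set system $M=(V,D)$ ($V$ finite, $D$ a nonempty family of subsets of $V$, write $Z\in M$ for $Z\in D$): $\oplus$ is symmetric difference; pivot $M*X=(V,\{Z\oplus X:Z\in D\})$; loop complementation $M+w=(V,D\oplus\{Z\cup\{w\}:Z\in D,w\notin Z\})$; operations apply left to right; dual pivot $M\,\bar{*}\,w=M+w*w+w$; operations on distinct elements commute and $M\,\bar{*}\,V$ denotes applying $\bar{*}\,w$ for all $w\in V$ (explicitly, $X\in M\,\bar{*}\,V$ iff $|\{Z\in M: X\subseteq Z\}|$ is odd). $d_M=\min\{|Z|:Z\in M\}$. The cycle space $C\subseteq\mathbb{F}_2^V$ of a binary matroid is the subspace spanned by the characteristic vectors of its circuits, and $C^\perp$ is its orthogonal complement with respect to the standard bilinear form over $\mathbb{F}_2$. *)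

(* Defs.v *)
From HB Require Import structures.
From mathcomp Require Import all_boot all_order all_algebra.

Set Implicit Arguments.
Unset Strict Implicit.
Unset Printing Implicit Defensive.

Import GRing.Theory.
Local Open Scope ring_scope.

Definition symdiff (T : finType) (A B : {set T}) : {set T} :=
  (A :\: B) :|: (B :\: A).

Lemma in_symdiff (T : finType) (A B : {set T}) (x : T) :
  (x \in symdiff A B) = (x \in A) (+) (x \in B).
Proof. by rewrite !inE; case: (x \in A); case: (x \in B). Qed.

(* A set system on the ground set V is given by its family D : {set {set V}}.
   Nonemptiness is not part of the type; it is required in [is_matroid]. *)
Section SetSystems.
Variable V : finType.
Implicit Types (D : {set {set V}}) (X Z : {set V}) (w : V).

Definition pivot D X : {set {set V}} := [set symdiff Z X | Z in D].

Definition loopc D w : {set {set V}} :=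
  symdiff D [set w |: Z | Z in D & w \notin Z].

Definition dual_pivot1 D w : {set {set V}} :=
  loopc (pivot (loopc D w) [set w]) w.

(* The order of [enum X] is irrelevant, see [dual_pivot1C]. *)
Definition dual_pivot D X : {set {set V}} := foldl dual_pivot1 D (enum X).

(* The default #|V| affects the value only when D is empty, as #|Z| <= #|V|
   for every Z. *)
Definition min_card D : nat := \big[minn/#|V|]_(Z in D) #|Z|.

Lemma in_dual_pivot1 D w X :
  (X \in dual_pivot1 D w) =
    (X \in D) (+) ((w \notin X) && (w |: X \in D)).
Proof.
have in_pivot (E : {set {set V}}) (Y : {set V}) : (Y \in pivot E [set w]) = (symdiff Y [set w] \in E).
  have sK (Z : {set V}) : symdiff (symdiff Z [set w]) [set w] = Z.
    by apply/setP=> x; rewrite !in_symdiff addbK.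
  apply/imsetP/idP=> [[Z ZE ->]|YE]; first by rewrite sK.
  by exists (symdiff Y [set w]); rewrite ?sK.
have in_loopc (E : {set {set V}}) (Y : {set V}) :
    (Y \in loopc E w) = (Y \in E) (+) ((w \in Y) && (Y :\ w \in E)).
  rewrite in_symdiff; congr (_ (+) _); apply/imsetP/andP.
    by case=> Z; rewrite !inE => /andP[ZE wZ] ->; rewrite setU11 setU1K.
  by case=> wY YE; exists (Y :\ w); rewrite ?setD1K // !inE eqxx YE.
have s0 (Y : {set V}) : w \in Y -> symdiff Y [set w] = Y :\ w.
  move=> wY; apply/setP=> x; rewrite in_symdiff !inE.
  by case: eqVneq => [->|]; rewrite ?wY ?addbF.
have s1 (Y : {set V}) : w \notin Y -> symdiff Y [set w] = w |: Y.
  move=> wY; apply/setP=> x; rewrite in_symdiff !inE.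
  by case: eqVneq => [->|]; rewrite ?(negPf wY) ?addbF.
rewrite !in_loopc !in_pivot !in_loopc.
have [wX|wX] := boolP (w \in X) => /=.
  have wX' : w \notin X :\ w by rewrite !inE eqxx.
  rewrite s0 // s1 // (negPf wX') /= setD1K // wX /=.
  by case: (X :\ w \in D); case: (X \in D).
by rewrite s1 // setU11 setU1K //=; case: (X \in D); case: (w |: X \in D).
Qed.

Lemma dual_pivot1C D w w' :
  dual_pivot1 (dual_pivot1 D w) w' = dual_pivot1 (dual_pivot1 D w') w.
Proof.
have [->//|nww'] := eqVneq w w'.
apply/setP=> X; rewrite !in_dual_pivot1 !inE !negb_or nww' eq_sym nww' /=.
rewrite [w |: (w' |: X)]setUCA.
by case: (w \in X); case: (w' \in X); case: (X \in D);
   case: (w |: X \in D); case: (w' |: X \in D); case: (w' |: (w |: X) \in D).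
Qed.

End SetSystems.

Section Matroids.
Variable V : finType.
Implicit Types (beta : {set {set V}}) (X C : {set V}).

Definition is_matroid beta : Prop :=
  beta != set0 /\
  forall B1 B2, B1 \in beta -> B2 \in beta ->
  forall x, x \in B1 :\: B2 ->
  exists2 y, y \in B2 :\: B1 & y |: (B1 :\ x) \in beta.

Definition indep beta X : bool := [exists B in beta, X \subset B].

(* Representability over F_2: V indexes the columns A v of a matrix, and a
   set is independent iff the family of its columns is linearly independent.
   [free] is applied to a list with repetitions, so that equal columns at
   distinct indices are dependent. *)
Definition is_binary_matroid beta : Prop :=
  is_matroid beta /\
  exists (r : nat) (A : V -> 'cV['F_2]_r),
    forall X, indep beta X = free [seq A v | v in X].

Definition circuit beta C : bool := minset (fun X => ~~ indep beta X) C.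

(* The space F_2^V; F_2 is seen as a module over itself so that the function
   type inherits the vector space structure. *)
Notation F2V := {ffun V -> ('F_2)^o}.

Definition char_vec X : F2V := [ffun v => (v \in X)%:R].

Definition cycle_space beta : {vspace F2V} :=
  <<[seq char_vec C | C : {set V} in circuit beta]>>%VS.

Definition dot (x y : F2V) : 'F_2 := \sum_(v : V) (x v : 'F_2) * (y v : 'F_2).

Lemma dot_is_linear_l (y : F2V) : scalar (dot^~ y).
Proof.
move=> a x x'; rewrite /dot mulr_sumr -big_split; apply: eq_bigr => v _.
by rewrite !ffunE mulrDl mulrA.
Qed.

Lemma dotC (x y : F2V) : dot x y = dot y x.
Proof. by apply: eq_bigr => v _; rewrite mulrC. Qed.

Lemma dot_is_linear_r (x : F2V) : scalar (dot x).
Proof. by move=> a y y'; rewrite !(dotC x) dot_is_linear_l. Qed.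

Lemma dot_is_bilinear :
  bilinear_for *%R (idfun \; *%R : 'F_2 -> 'F_2 -> 'F_2) dot.
Proof. by split; [exact: dot_is_linear_l | exact: dot_is_linear_r]. Qed.

HB.instance Definition _ :=
  bilinear_isBilinear.Build 'F_2 F2V F2V 'F_2
    (GRing.Scale.Law.clone _ _ ( *%R) _)
    (GRing.Scale.Law.clone _ _ (idfun \; *%R) _) dot dot_is_bilinear.

Lemma dot_is_symmetric (x y : F2V) :
  dot x y = (-1) ^+ false * idfun (dot y x).
Proof. by rewrite expr0 mul1r dotC. Qed.

HB.instance Definition _ :=
  isHermitianSesquilinear.Build 'F_2 F2V false idfun dot dot_is_symmetric.

Definition cocycle_space beta : {vspace F2V} := orthov dot (cycle_space beta).

End Matroids.

(* Main.v *)
(* Let N be the cycle space.  A set Z is a basis of M iff its complement S is an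
   information set of N: the coordinates in S map N bijectively onto F_2^S.  By
   Cauchy-Binet, the number of information sets inside Y is, modulo 2, the
   determinant of the Gram matrix of a basis of N for the form
   B_Y(c, d) = \sum_(v in Y) c_v d_v.  Hence X belongs to the dual pivot of M on
   V iff B_(~: X) is nondegenerate on N.

   The bicycle space R is the radical of B_V on N.  If B_(~: X) is nondegenerate
   on N, an element of R vanishing on X is in its radical, so R injects into
   F_2^X and \dim R <= #|X|.  Conversely, let X be an information set of R.  If c
   is in the radical of B_(~: X), then B_X(c, d) = B_V(c, d) = 0 for all d in R;
   as R maps onto F_2^X, c vanishes on X, so c is in R, and c = 0. *)
From HB Require Import structures.
Require Import Defs.
From mathcomp Require Import all_boot all_order all_algebra.
From mathcomp Require Import fingroup perm.

Set Implicit Arguments.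
Unset Strict Implicit.
Unset Printing Implicit Defensive.

Import GRing.Theory.
Local Open Scope ring_scope.

(** * Coordinate sets that determine the vectors of a subspace, and information sets *)

Section CoordInj.
Variables (F : fieldType) (V : finType).
Implicit Types (U : {vspace {ffun V -> F^o}}) (S : {set V}).

Definition restrict S (c : {ffun V -> F^o}) : 'rV[F]_#|S| :=
  \row_j c (enum_val j).

Lemma restrict_is_linear S : linear (restrict S).
Proof. by move=> a c d; apply/rowP=> j; rewrite !mxE !ffunE. Qed.

HB.instance Definition _ S :=
  GRing.isLinear.Build F {ffun V -> F^o} 'rV[F]_#|S| *:%R (restrict S)
    (restrict_is_linear S).

(** The inclusion-minimal sets S with this property are the information sets of U. *)
Definition coord_inj U S : bool :=
  (U :&: lker (linfun (restrict S)) == 0)%VS.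

Lemma coord_injP U S :
  reflect (forall c, c \in U -> {in S, forall v, c v = 0} -> c = 0)
          (coord_inj U S).
Proof.
have kerE c : (c \in lker (linfun (restrict S))) <->
    {in S, forall v, c v = 0}.
  rewrite memv_ker lfunE /=; split=> [/eqP/rowP c0 v vS|c0].
    by have := c0 (enum_rank_in vS v); rewrite !mxE enum_rankK_in.
  by apply/eqP/rowP=> j; rewrite !mxE c0 // enum_valP.
apply: (iffP eqP) => [U0 c cU /kerE cS|injU].
  by apply/eqP; rewrite -memv0 -U0 memv_cap cU.
apply/eqP; rewrite -subv0; apply/subvP=> c.
by rewrite memv_cap memv0 => /andP[cU /kerE cS]; rewrite (injU c).
Qed.

(** By minimality some nonzero c in U vanishes on [S :\ v], and injectivity on S excludes [c v = 0].
    Up to scale, c restricts to a unit vector of F^S. *)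
Lemma minset_coord_inj_unit U S v : minset (coord_inj U) S -> v \in S ->
  exists2 c, c \in U & {in S :\ v, forall w, c w = 0} /\ c v != 0.
Proof.
case/minsetP=> injS minS vS.
have nU : ~~ coord_inj U (S :\ v).
  apply/negP=> injSv; have /setP/(_ v) := minS _ injSv (subD1set _ _).
  by rewrite !inE eqxx vS.
have /subvPn[c] : ~~ (U :&: lker (linfun (restrict (S :\ v))) <= 0)%VS.
  by rewrite subv0.
rewrite memv_cap memv0 => /andP[cU cker] cn0; exists c => //.
have c0 : {in S :\ v, forall w, c w = 0}.
  move=> w wS; move: cker; rewrite memv_ker lfunE => /eqP/rowP.
  by move/(_ (enum_rank_in wS w)); rewrite !mxE enum_rankK_in.
split=> //; apply: contraNneq cn0 => cv; apply/eqP.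
apply: (coord_injP _ _ injS) => // w wS.
by have [->//|wv] := eqVneq w v; apply: c0; rewrite !inE wv.
Qed.

(** The unit vectors just obtained show that restriction maps U onto F^S, and it is injective on
    U. *)
Lemma card_minset_coord_inj U S :
  minset (coord_inj U) S -> #|S| = \dim U.
Proof.
move=> minS; have [injS _] := minsetP minS.
rewrite -(limg_dim_eq (eqP injS)).
suff -> : (linfun (restrict S) @: U = fullv)%VS by rewrite dimvf /dim /= mul1n.
apply/vspaceP=> r; rewrite memvf [r]row_sum_delta.
apply: rpred_sum => j _; apply: rpredZ.
have [c cU [c0 cv]] := minset_coord_inj_unit minS (enum_valP j).
suff -> : delta_mx 0 j = (c (enum_val j))^-1 *: linfun (restrict S) c.
  by apply: rpredZ; apply: memv_img.
apply/rowP=> i; rewrite lfunE !mxE /=.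
have [->|ij] := eqVneq i j; first by rewrite mulVf.
rewrite (c0 (enum_val i)) ?mulr0 // !inE enum_valP andbT.
by apply: contra ij => /eqP/enum_val_inj->.
Qed.

Lemma coord_inj_setT U : coord_inj U setT.
Proof. by apply/coord_injP=> c _ c0; apply/ffunP=> v; rewrite c0 ?ffunE. Qed.

Lemma dim_coord_inj U S : coord_inj U S -> (\dim U <= #|S|)%N.
Proof.
case/minset_exists=> S' minS' sS'S.
by rewrite -(card_minset_coord_inj minS') subset_leq_card.
Qed.

End CoordInj.

(** * Cauchy-Binet expansion of a Gram determinant *)

Section CauchyBinet.
Variables (R : comNzRingType) (V : finType) (m : nat).
Implicit Types (G H : 'I_m -> V -> R) (f : {ffun 'I_m -> V}).

Definition minor G f : 'M[R]_m := \matrix_(i, j) G i (f j).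

Lemma minor_noninj G f : ~~ injectiveb f -> \det (minor G f) = 0.
Proof.
case/injectivePn=> i [j ij fij].
rewrite -det_tr; apply: (determinant_alternate ij) => k.
by rewrite !mxE fij.
Qed.

(** Distributing the products in the Leibniz formula picks one [v = f i] for each row i; the sum
    over permutations then rebuilds a determinant. *)
Lemma det_gram_ffun G H (Y : {set V}) :
  \det (\matrix_(i, j) \sum_(v in Y) G i v * H j v) =
  \sum_(f in ffun_on Y) (\prod_i G i (f i)) * \det (minor H f).
Proof.
(* After transposition the entry at [(i, s i)] is [H (s i) (f i)], the factor that occurs on the
   left. *)
under [RHS]eq_bigr => f _.
  rewrite -[\det _]det_tr /determinant mulr_sumr; over.
rewrite exchange_big; apply: eq_bigr => s _ /=.
under eq_bigr => i _ do rewrite mxE.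
rewrite bigA_distr_big mulr_sumr; apply: eq_bigr => f _.
rewrite mulrCA big_split; congr (_ * (_ * _)).
by apply: eq_bigr => i _; rewrite !mxE.
Qed.

(** The functions with image S are f composed with a permutation s. Permuting columns multiplies the
    minor of H by the sign of s, and these signs turn the products of entries of G into a
    determinant. *)
Lemma sum_minor_image G H f (S := f @: setT) : injective f ->
  \sum_(e : {ffun 'I_m -> V} | e @: setT == S)
     (\prod_i G i (e i)) * \det (minor H e) =
  \det (minor G f) * \det (minor H f).
Proof.
move=> injf; pose h (s : 'S_m) := [ffun i => f (s i)].
have injh : injective h.
  move=> s t /ffunP hst; apply/permP=> i.
  by have := hst i; rewrite !ffunE => /injf.
have -> : \sum_(e : {ffun 'I_m -> V} | e @: setT == S)
     (\prod_i G i (e i)) * \det (minor H e) =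
   \sum_(e in h @: setT) (\prod_i G i (e i)) * \det (minor H e).
  apply: eq_bigl => e; apply/eqP/imsetP=> [eS|[s _ ->]].
    have /fin_all_exists[g fg] : forall i, exists j, f j = e i.
      move=> i; have : e i \in S by rewrite -eS imset_f.
      by case/imsetP=> j _ ->; exists j.
    have injg : injective g.
      have injE : injective e.
        suff /imset_injP injE : #|e @: setT| == #|[set: 'I_m]|.
          by move=> i j; apply: injE; rewrite inE.
        by rewrite eS card_imset.
      by move=> i j gij; apply: injE; rewrite -!fg gij.
    by exists (perm injg) => //; apply/ffunP=> i; rewrite ffunE permE fg.
  apply/setP=> v; apply/imsetP/imsetP=> [[i _ ->]|[i _ ->]].
    by exists (s i); rewrite ?ffunE.
  by exists ((s^-1)%g i); rewrite ?ffunE ?permKV.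
rewrite big_imset /=; last by move=> s t _ _; apply: injh.
rewrite [\det (minor G f)]/determinant mulr_suml.
apply: eq_big => [s|s _]; first by rewrite inE.
have -> : minor H (h s) = col_perm s (minor H f).
  by apply/matrixP=> i j; rewrite !mxE ffunE.
rewrite col_permE det_mulmx det_perm odd_permV [\det _ * _]mulrC mulrA.
rewrite [_ * (-1) ^+ _]mulrC; congr (_ * _ * _).
by apply: eq_bigr => i _; rewrite mxE ffunE.
Qed.
End CauchyBinet.

(** * Determinant criteria for injectivity and nondegeneracy on a subspace *)

Section GramDeterminant.
Variables (F : fieldType).

(** A row vector killed by this matrix is the coordinate vector of an element of U killed by L. This
    serves for evaluation at chosen coordinates and for pairing with a basis. *)
Lemma det_vbasisP (vT : vectType F) (U : {vspace vT})
    (L : {linear vT -> 'rV[F]_(\dim U)}) :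
  reflect (forall c, c \in U -> L c = 0 -> c = 0)
          (\det (\matrix_(i < \dim U) L (vbasis U)`_i) != 0).
Proof.
set A := \matrix_i _.
have mulA (u : 'rV_(\dim U)) : u *m A = L (\sum_i u 0 i *: (vbasis U)`_i).
  rewrite mulmx_sum_row linear_sum; apply: eq_bigr => i _.
  by rewrite rowK linearZ.
apply: (iffP idP) => [/det0P nA c cU Lc0|injL].
  rewrite (coord_vbasis cU) big1 // => i _.
  suff /rowP/(_ i) : \row_i coord (vbasis U) i c = 0.
    by rewrite !mxE => ->; rewrite scale0r.
  apply/eqP; apply: contraPT Lc0 => n0 Lc0; case: nA.
  exists (\row_i coord (vbasis U) i c) => //.
  rewrite mulA -Lc0 {2}(coord_vbasis cU); congr (L _).
  by apply: eq_bigr => j _; rewrite mxE.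
apply/det0P=> -[u u0 uA]; case/eqP: u0; apply/rowP=> i; rewrite mxE.
have /freeP := basis_free (vbasisP U); apply => //.
apply: injL; last by rewrite -mulA.
by apply: rpred_sum => j _; rewrite rpredZ // vbasis_mem // mem_nth ?size_tuple.
Qed.

Variable V : finType.
Implicit Types (U : {vspace {ffun V -> F^o}}) (S Y : {set V}).

Definition basis_coord U (i : 'I_(\dim U)) (v : V) : F := (vbasis U)`_i v.

Lemma det_minor_neq0 U (f : {ffun 'I_(\dim U) -> V}) :
  (\det (minor (@basis_coord U) f) != 0) = coord_inj U (f @: setT).
Proof.
pose L (c : {ffun V -> F^o}) : 'rV[F]_(\dim U) := \row_j c (f j).
have linL : linear L by move=> a c d; apply/rowP=> j; rewrite !mxE !ffunE.
pose LL : {linear _ -> _} := HB.pack L (GRing.isLinear.Build _ _ _ _ L linL).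
have -> : minor (@basis_coord U) f = \matrix_i LL (vbasis U)`_i.
  by apply/matrixP=> i j; rewrite !mxE.
apply/det_vbasisP/coord_injP=> injL c cU c0; apply: injL => //.
  by apply/rowP=> j; rewrite !mxE c0 // imset_f.
by move=> _ /imsetP[j _ ->]; have /rowP/(_ j) := c0; rewrite !mxE.
Qed.

(** The Gram determinant of B_Y on U, the quantity that Cauchy-Binet expands. *)
Definition nondegenerate U Y :=
  \det (\matrix_(i, j) \sum_(v in Y)
     @basis_coord U i v * @basis_coord U j v) != 0.

Lemma nondegenerateP U Y :
  reflect (forall c, c \in U ->
             (forall d, d \in U -> \sum_(v in Y) (c v * d v : F) = 0) -> c = 0)
          (nondegenerate U Y).
Proof.
pose L (c : {ffun V -> F^o}) : 'rV[F]_(\dim U) :=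
  \row_j \sum_(v in Y) (c v * @basis_coord U j v : F).
have linL : linear L.
  move=> a c d; apply/rowP=> j; rewrite !mxE mulr_sumr -big_split.
  by apply: eq_bigr => v _; rewrite !ffunE mulrDl mulrA.
pose LL : {linear _ -> _} := HB.pack L (GRing.isLinear.Build _ _ _ _ L linL).
rewrite /nondegenerate; set A := (X in \det X).
have -> : A = \matrix_i LL (vbasis U)`_i.
  by apply/matrixP=> i j; rewrite !mxE.
apply: (iffP (det_vbasisP _)) => injL c cU c0; apply: injL => //.
  apply/rowP=> j; rewrite !mxE; apply: c0.
  by rewrite vbasis_mem // mem_nth ?size_tuple.
move=> d dU; rewrite (coord_vbasis dU).
under eq_bigr => v _.
  rewrite sum_ffunE mulr_sumr; over.
rewrite exchange_big big1 //= => j _.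
have /rowP/(_ j) := c0; rewrite !mxE => c0j.
under eq_bigr => v _ do rewrite ffunE mulrCA.
by rewrite -mulr_sumr c0j mulr0.
Qed.

End GramDeterminant.

(** * Parity of the number of information sets over F_2 *)

Section GramParity.
Variable V : finType.
Implicit Types (U : {vspace {ffun V -> ('F_2)^o}}) (S Y : {set V}).

(** With both families equal, Cauchy-Binet gives a sum of squared maximal minors. Over F_2 each
    square is 1 or 0 according to whether S is an information set, so the sum is the count modulo
    2. *)
Lemma odd_card_coord_inj U Y :
  odd #|[set S : {set V} | [&& S \subset Y, coord_inj U S & #|S| == \dim U]]|
  = nondegenerate U Y.
Proof.
have F2E (d : 'F_2) : d * d = (d != 0)%:R.
  by case: d => [[|[|//]] ?]; apply: val_inj.
rewrite /nondegenerate det_gram_ffun.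
rewrite (partition_big (fun f : {ffun _} => f @: setT) (fun S => S \subset Y)) /=;
  last first.
  move=> f /ffun_onP fY; apply/subsetP=> _ /imsetP[i _ ->]; exact: fY.
rewrite (eq_bigr (fun S => (coord_inj U S && (#|S| == \dim U))%:R)).
  rewrite -natr_sum -big_mkcondr sum1dep_card.
  by rewrite -(dvdn_pcharf (pchar_Fp (isT : prime 2))) dvdn2 negbK.
move=> S sSY.
transitivity (\sum_(f : {ffun 'I_(\dim U) -> V} | f @: setT == S)
  (\prod_i basis_coord i (f i)) * \det (minor (@basis_coord _ _ U) f)).
  apply: eq_bigl => f; apply: andb_idl => /eqP fS.
  by apply/ffun_onP=> i; apply: (subsetP sSY); rewrite -fS imset_f.
(* If the size of S differs from [\dim U], no f with image S is injective, and all minors vanish. *)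
have [cS|cS] := eqVneq #|S| (\dim U); last first.
  rewrite andbF big1 // => f /eqP fS; rewrite minor_noninj ?mulr0 //.
  apply: contra cS => /injectiveP injf.
  by rewrite -fS card_imset // cardsT card_ord.
pose f := [ffun i : 'I_(\dim U) => enum_val (cast_ord (esym cS) i)].
have injf : injective f.
  by move=> i j; rewrite !ffunE => /enum_val_inj/cast_ord_inj.
have fS : f @: setT = S.
  apply/eqP; rewrite eqEcard card_imset // cardsT card_ord cS leqnn andbT.
  by apply/subsetP=> _ /imsetP[i _ ->]; rewrite ffunE enum_valP.
by rewrite andbT -fS sum_minor_image // F2E det_minor_neq0.
Qed.

End GramParity.

(** * Binary matroids: independent sets, cycle space and bases in linear terms *)

Lemma free_imageP (F : fieldType) (vT : vectType F) (V : finType) (A : V -> vT)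
    (X : {set V}) :
  reflect (forall c : V -> F, \sum_(v in X) c v *: A v = 0 ->
             {in X, forall v, c v = 0})
          (free [seq A v | v in X]).
Proof.
(* [free] indexes coefficients by list positions; [enum_val] re-indexes them by elements of X, which
   keeps repeated columns apart. *)
have nthE (i : 'I_#|X|) : (map_tuple A (enum_tuple X))`_i = A (enum_val i).
  by rewrite (nth_map (enum_val i)) -?enum_val_nth ?size_tuple.
have -> : [seq A v | v in X] = map_tuple A (enum_tuple X) by [].
apply: (iffP (@freeP _ _ _ (map_tuple A (enum_tuple X)))) => [freeA c c0 v vX|freeA k k0 i].
  have /(_ _ (enum_rank_in vX v)) := freeA (fun i => c (enum_val i)).
  rewrite enum_rankK_in //; apply.
  rewrite big_enum_val in c0; rewrite -[RHS]c0.
  by apply: eq_bigr => i _; rewrite nthE.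
(* This transports [k] along [enum_val]; the default 0 is taken only outside X. *)
pose c v := if [pick i : 'I_#|X| | enum_val i == v] is Some i then k i else 0.
have cE j : c (enum_val j) = k j.
  rewrite /c; case: pickP => [j' /eqP/enum_val_inj-> //|/(_ j)].
  by rewrite eqxx.
rewrite -cE; apply: freeA (enum_valP i).
rewrite big_enum_val -[RHS]k0; apply: eq_bigr => j _.
by rewrite nthE cE.
Qed.

Section BinaryMatroid.
Variable V : finType.
Local Notation F2V := {ffun V -> ('F_2)^o}.
Implicit Types (U : {vspace F2V}) (X Z C : {set V}) (c : F2V).

Definition supp c : {set V} := [set v | c v != 0].

Lemma char_vec_supp c : char_vec (supp c) = c.
Proof.
apply/ffunP=> v; rewrite ffunE inE.
by case: (c v) => [[|[|//]] ?]; apply: val_inj.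
Qed.

Lemma coord_inj_setCP U X :
  reflect (forall c, c \in U -> supp c \subset X -> c = 0) (coord_inj U (~: X)).
Proof.
apply: (iffP (coord_injP _ _)) => injU c cU c0; apply: injU => //.
  move=> v; rewrite inE => vX; apply/eqP; apply: contraR vX => cv.
  by apply: (subsetP c0); rewrite inE.
by apply/subsetP=> v; rewrite inE; apply: contraR => vX; rewrite c0 ?inE.
Qed.

Variables (beta : {set {set V}}) (r : nat) (A : V -> 'cV['F_2]_r).
Hypothesis indepA : forall X, indep beta X = free [seq A v | v in X].

Definition col_comb (c : F2V) : 'cV['F_2]_r := \sum_v (c v : 'F_2) *: A v.

Lemma col_comb_is_linear : linear col_comb.
Proof.
move=> a c d; rewrite /col_comb scaler_sumr -big_split; apply: eq_bigr => v _.
by rewrite !ffunE scalerDl scalerA.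
Qed.

HB.instance Definition _ :=
  GRing.isLinear.Build 'F_2 F2V 'cV['F_2]_r *:%R col_comb col_comb_is_linear.

(** A linear dependence among the columns of X is a nonzero kernel vector with support in X. *)
Lemma indep_coord_inj X :
  indep beta X = coord_inj (lker (linfun col_comb)) (~: X).
Proof.
have kerE c : (c \in lker (linfun col_comb)) = (col_comb c == 0).
  by rewrite memv_ker lfunE.
rewrite indepA; apply/free_imageP/coord_inj_setCP => [freeA c|freeA c c0 v vX].
  rewrite kerE => /eqP c0 /subsetP cX; apply/ffunP=> v; rewrite ffunE.
  have [vX|vX] := boolP (v \in X).
    apply: freeA vX; rewrite -[RHS]c0 /col_comb [RHS](bigID (mem X)) /=.
    rewrite [X in _ + X]big1 ?addr0 // => w wX.
    have /eqP-> : c w == 0; last by rewrite scale0r.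
    by apply: contraR wX => cw; apply: cX; rewrite inE.
  by apply/eqP; apply: contraR vX => cv; apply: cX; rewrite inE.
pose d : F2V := [ffun v => if v \in X then c v else 0].
suff /ffunP/(_ v) : d = 0 by rewrite !ffunE vX.
apply: freeA.
  rewrite kerE /col_comb (bigID (mem X)) /= [X in _ + X]big1 ?addr0.
    apply/eqP; rewrite -[RHS]c0; apply: eq_bigr => w wX.
    by rewrite ffunE wX.
  by move=> w /negPf wX; rewrite ffunE wX scale0r.
by apply/subsetP=> w; rewrite inE ffunE; case: ifP; rewrite // eqxx.
Qed.

(** A circuit C is dependent, so C contains the support of a nonzero kernel vector; by minimality
    the support is C, and over F_2 the vector is [char_vec C]. Conversely, the support of a nonzero
    kernel vector contains a circuit, and subtracting it allows induction on the size of the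
    support. *)
Lemma cycle_spaceE : cycle_space beta = lker (linfun col_comb).
Proof.
set N := lker _; have depP c : c \in N -> c != 0 -> ~~ indep beta (supp c).
  move=> cN c0; rewrite indep_coord_inj; apply: contra c0 => /coord_inj_setCP.
  by move/(_ c cN (subxx _))/eqP.
have circN C : circuit beta C -> char_vec C \in N.
  case/minsetP=> depC minC.
  apply: contraNT depC => CnN; rewrite indep_coord_inj.
  apply/coord_inj_setCP=> c cN cC; apply/eqP; apply: contraR CnN => c0.
  by rewrite -(minC _ (depP c cN c0) cC) char_vec_supp.
apply/eqP; rewrite eqEsubv; apply/andP; split.
  by apply/span_subvP=> _ /imageP[C circC ->]; apply: circN.
apply/subvP=> c; have [n] := ubnP #|supp c|; elim: n c => // n IHn c lt_cn cN.
have [->|c0] := eqVneq c 0; first exact: mem0v.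
have [C circC sCc] :=
  @minset_exists _ (fun X => ~~ indep beta X) _ (depP c cN c0).
have CN : char_vec C \in cycle_space beta.
  by apply/memv_span/imageP; exists C.
rewrite -(subrK (char_vec C) c) rpredD // IHn ?rpredB ?circN //.
(* The empty set is independent, so C has an element, at which the support strictly shrinks. *)
have /set0Pn[v vC] : C != set0.
  apply: contraTneq circC => ->; apply/negP => /minsetP[].
  by rewrite indep_coord_inj setC0 coord_inj_setT.
have F2E (x : 'F_2) : x != 0 -> x = 1.
  by case: x => [[|[|//]] ?] // _; apply: val_inj.
have cE w : w \in C -> c w = 1.
  by move/(subsetP sCc); rewrite inE; apply: F2E.
rewrite -ltnS; apply: leq_trans lt_cn; rewrite ltnS.
apply/proper_card/properP; split.
  apply/subsetP=> w; rewrite !inE !ffunE; apply: contraNneq => cw.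
  have [/cE|_] := boolP (w \in C).
    by rewrite cw => /eqP; rewrite eq_sym oner_eq0.
  by rewrite cw subr0.
by exists v; rewrite !inE ?cE ?oner_eq0 // !ffunE vC cE // subrr eqxx.
Qed.

(** Complements of bases are minimal among the sets that determine the cycle space, which fixes
    their size. Conversely, an independent set whose complement has that size equals the basis
    containing it. *)
Lemma basis_coord_inj Z : is_matroid beta ->
  (Z \in beta) =
  coord_inj (cycle_space beta) (~: Z) && (#|~: Z| == \dim (cycle_space beta)).
Proof.
rewrite cycle_spaceE => -[_ exch]; set N := lker _.
have cardB B : B \in beta -> #|~: B| = \dim N.
  move=> Bb; apply: card_minset_coord_inj; apply/minsetP; split.
    by rewrite -indep_coord_inj; apply/existsP; exists B; rewrite Bb /=.
  move=> S injS sS; have : indep beta (~: S) by rewrite indep_coord_inj setCK.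
  case/existsP=> B' /andP[B'b sSB'].
  have sBS : B \subset ~: S by rewrite -setCS setCK.
  have sBB' := subset_trans sBS sSB'.
  suff B'B : B' \subset B.
    apply/eqP; rewrite eqEsubset sS /= -[S]setCK setCS.
    exact: subset_trans sSB' B'B.
  (* Exchanging x out of B' would require an element of B outside B', but B is contained in B'. *)
  apply/subsetP=> x xB'; apply/negPn/negP=> xB.
  have xBB' : x \in B' :\: B by rewrite inE xB.
  have [y] := exch _ _ B'b Bb x xBB'.
  by rewrite inE => /andP[/negP + yB]; rewrite (subsetP sBB').
apply/idP/andP=> [Zb|[injZ /eqP cardZ]].
  rewrite cardB // eqxx -indep_coord_inj.
  by split=> //; apply/existsP; exists Z; rewrite Zb /=.
rewrite -indep_coord_inj in injZ; have /existsP[B /andP[Bb sZB]] := injZ.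
suff -> : Z = B by [].
apply/eqP; rewrite -(inj_eq (@setC_inj V)) eq_sym eqEcard setCS sZB.
by rewrite cardZ (cardB _ Bb) leqnn.
Qed.

End BinaryMatroid.

(** * Membership in the full dual pivot, and computing the minimum cardinality *)

Section DualPivot.
Variable V : finType.
Implicit Types (D : {set {set V}}) (X : {set V}).

Lemma in_dual_pivotT D X :
  (X \in dual_pivot D setT) = odd #|[set Z in D | X \subset Z]|.
Proof.
(* Generalised to the elements processed so far: these alone may be added to Y. When s lists all of
   V, the upper bound on Z disappears. *)
have foldE (s : seq V) : uniq s -> forall Y,
    (Y \in foldl (@dual_pivot1 V) D s) =
    odd #|[set Z in D | Y \subset Z & Z \subset Y :|: [set:: s]]|.
  elim/last_ind: s => [_ Y|s w IHs].
    rewrite -[LHS]oddb; congr odd.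
    have -> : [set:: [::]] = set0 :> {set V} by apply/setP=> v; rewrite !inE.
    rewrite setU0; set E := [set _ in _ | _].
    have [YD|YD] := boolP (Y \in D).
      suff -> : E = [set Y] by rewrite cards1.
      apply/setP=> Z; rewrite !inE -eqEsubset eq_sym.
      by case: eqVneq => [->|]; rewrite ?andbF ?YD.
    suff -> : E = set0 by rewrite cards0.
    apply/setP=> Z; rewrite !inE -eqEsubset eq_sym.
    by case: eqVneq => [->|]; rewrite ?andbF ?(negPf YD).
  rewrite rcons_uniq -cats1 => /andP[ws /IHs{}IHs] Y.
  rewrite foldl_cat /= in_dual_pivot1 !IHs.
  have -> : [set:: s ++ [:: w]] = w |: [set:: s].
    by apply/setP=> v; rewrite !inE mem_cat inE orbC.
  have [wY|wY] := boolP (w \in Y) => /=.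
    rewrite addbF setUA [Y :|: [set w]](setUidPl _) //.
    by rewrite sub1set.
  rewrite -oddD; congr odd.
  (* The sets containing w are those counted at [w |: Y], the sets avoiding w those counted at Y. *)
  rewrite -[RHS](cardsID [set Z : {set V} | w \in Z]) addnC.
  congr (_ + _)%N; apply: eq_card => Z; rewrite !inE.
    rewrite subUset sub1set setUCA -setUA.
    by case: (w \in Z); rewrite ?andbF ?andbT.
  rewrite [RHS]andbCA; congr (_ && _); have [wZ|wZ] := boolP (w \in Z) => /=.
    apply/negbTE/negP => /andP[_ /subsetP/(_ w wZ)].
    by rewrite !inE (negPf wY) (negPf ws).
  rewrite setUCA; congr (_ && _); apply/idP/idP=> [sZ|/subsetP sZ].
    exact: subset_trans sZ (subsetUr _ _).
  apply/subsetP=> v vZ; have := sZ v vZ; rewrite !inE.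
  by case: eqVneq vZ wZ => [-> -> //|].
rewrite foldE ?enum_uniq //; congr odd; apply: eq_card => Z; rewrite !inE.
suff -> : [set:: enum [set: V]] = setT by rewrite setUT subsetT andbT.
by apply/setP=> v; rewrite !inE mem_enum inE.
Qed.

(** The bound by [#|V|] takes care of the default value in [min_card]. *)
Lemma min_card_eq D k :
  (k <= #|V|)%N -> (exists2 Z, Z \in D & #|Z| = k) ->
  (forall Z, Z \in D -> (k <= #|Z|)%N) -> min_card D = k.
Proof.
move=> kV [Z ZD cZ] lek; apply/eqP; rewrite eqn_leq; apply/andP; split.
  by rewrite -cZ /min_card; exact: (@Order.TotalTheory.bigmin_le_cond _ nat).
by rewrite /min_card; elim/big_ind: _ => // x y kx ky; rewrite leq_min kx.
Qed.

End DualPivot.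

(** * The bicycle space as a radical: lower bound and attainment *)

Theorem theorem31 (V : finType) (beta : {set {set V}}) :
  is_binary_matroid beta ->
  min_card (dual_pivot beta [set: V]) =
    \dim (cycle_space beta :&: cocycle_space beta)%VS.
Proof.
move=> [matb [r [A indepA]]].
set N := cycle_space beta; set R := (N :&: _)%VS.
have memR c : reflect (c \in N /\ forall d, d \in N -> dot c d = 0) (c \in R).
  rewrite memv_cap; apply: (iffP andP) => -[cN cO]; split=> //.
    by move/mem_orthovP: cO.
  exact/mem_orthovP.
have dotE (X : {set V}) (c d : {ffun V -> ('F_2)^o}) :
    dot c d = \sum_(v in X) (c v : 'F_2) * d v +
              \sum_(v in ~: X) (c v : 'F_2) * d v.
  rewrite /dot (bigID (mem X)) /=; congr (_ + _).
  by apply: eq_bigl => v; rewrite inE.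
have memE X : (X \in dual_pivot beta setT) = nondegenerate N (~: X).
  rewrite in_dual_pivotT -odd_card_coord_inj; congr odd.
  (* Complementation matches the bases containing X with the information sets inside [~: X]. *)
  rewrite -(card_imset _ (@setC_inj V)); apply: eq_card => S.
  rewrite -[S in RHS]setCK (mem_imset _ _ (@setC_inj V)) !inE.
  by rewrite (basis_coord_inj indepA _ matb) setCS andbC.
have injR X : nondegenerate N (~: X) -> coord_inj R X.
  move/nondegenerateP=> ndN; apply/coord_injP=> c /memR[cN cO] cX.
  apply: ndN => // d dN; rewrite -[RHS](cO _ dN) (dotE X).
  by rewrite [X in _ = X + _]big1 ?add0r // => v /cX ->; rewrite mul0r.
apply: min_card_eq.
- by rewrite -cardsT dim_coord_inj // coord_inj_setT.
- have [X minX _] := minset_exists (coord_inj_setT R).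
  exists X; last exact: card_minset_coord_inj.
  have [/coord_injP injX _] := minsetP minX.
  rewrite memE; apply/nondegenerateP=> c cN c0.
  have cX0 : {in X, forall v, c v = 0}.
    (* On X the vector d is nonzero only at v, so B_X(c, d) is [c v * d v]; it equals B_V(c, d) = 0
       because c is in the radical of B_(~: X). *)
    move=> v vX; have [d /memR[dN dO] [d0 dv]] := minset_coord_inj_unit minX vX.
    have := dO _ cN; rewrite dotC (dotE X) c0 // addr0 (big_setD1 v) //= big1.
      by rewrite addr0 => /eqP; rewrite mulf_eq0 (negPf dv) orbF => /eqP.
    by move=> w /d0 ->; rewrite mulr0.
  (* Since c vanishes on X, B_V(c, d) reduces to B_(~: X)(c, d) = 0, which puts c in R. *)
  apply: injX => //; apply/memR; split=> // d dN.
  by rewrite (dotE X) c0 // addr0 big1 // => v /cX0 ->; rewrite mul0r.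
by move=> X; rewrite memE => /injR/dim_coord_inj.
Qed.
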